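(* For any $\phi_0\in[0,\pi)$, any $\lambda\in(-\infty,\infty)$ and any real $A\ge\frac12$, there exist real-valued potentials $p,q\in L^2[0,\infty)$ such that $$\limsup_{x\to\infty} x\sqrt{p(x)^2+q(x)^2}=A,$$ and $\lambda$ is an eigenvalue of the Dirac operator $L_{p,q}$ under the boundary condition $u(0)\sin\phi_0-v(0)\cos\phi_0=0$.
   Context: For real-valued functions $p,q\in L^2[0,\infty)$ (called potentials), the Dirac operator in canonical form on $L^2[0,\infty)\bigoplus L^2[0,\infty)$ is $$L_{p,q}\begin{pmatrix}u\\ v\end{pmatrix}=\begin{pmatrix}0&-1\\1&0\end{pmatrix}\frac{d}{dx}\begin{pmatrix}u\\ v\end{pmatrix}+\begin{pmatrix}-p&q\\ q&p\end{pmatrix}\begin{pmatrix}u\\ v\end{pmatrix}.$$ For $\phi_0\in[0,\pi)$, under the boundary condition $u(0)\sin\phi_0-v(0)\cos\phi_0=0$ the operator is self-adjoint. A real number $\lambda$ is an eigenvalue of $L_{p,q}$ under this boundary condition if there is a nontrivial solution $(u,v)^T$ ($u,v$ locally absolutely continuous on $[0,\infty)$, equation holding almost everywhere) of $L_{p,q}(u,v)^T=\lambda (u,v)^T$ that satisfies the boundary condition and belongs to $L^2[0,\infty)\bigoplus L^2[0,\infty)$. *)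

(* Defs.v *)
From mathcomp Require Import all_boot all_order all_algebra.
From mathcomp Require Import all_classical all_reals all_analysis.

Set Implicit Arguments.
Unset Strict Implicit.
Unset Printing Implicit Defensive.

Import Order.TTheory GRing.Theory Num.Theory.
Import numFieldNormedType.Exports.

Local Open Scope classical_set_scope.
Local Open Scope ring_scope.

(* Functions on the half-line [0, +oo[ are represented by total functions
   R -> R whose values at negative arguments are never used: every definition
   below depends only on the values on [0, +oo[. *)

(* The extension by zero of f from [0, +oo[ to R is a measurable function with
   finite L^2 norm. *)
Definition L2_halfline (R : realType) (f : R -> R) : Prop :=
  (f \_ `[0, +oo[) \in Lfun (@lebesgue_measure R) 2%:E.

Definition abs_continuous (R : realType) (a b : R) (f : R -> R) : Prop :=
  forall e : R, 0 < e -> exists2 d : R, 0 < d &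
    forall (n : nat) (s t : 'I_n -> R),
      (forall i, [/\ a <= s i, s i <= t i & t i <= b]) ->
      trivIset [set: 'I_n] (fun i => `]s i, t i[%classic) ->
      \sum_(i < n) (t i - s i) < d ->
      \sum_(i < n) `|f (t i) - f (s i)| < e.

Definition loc_abs_continuous (R : realType) (f : R -> R) : Prop :=
  forall b : R, 0 < b -> abs_continuous 0 b f.

Definition col2 (R : realType) (a b : R) : 'cV[R]_(1 + 1) :=
  col_mx a%:M b%:M.

Definition mx2 (R : realType) (a b c d : R) : 'M[R]_(1 + 1) :=
  block_mx a%:M b%:M c%:M d%:M.

(* The value at x of L_{p,q} (u, v)^T; it is meaningful only where u and v are
   derivable, since derive1 is total. *)
Definition dirac_op (R : realType) (p q u v : R -> R) (x : R) : 'cV[R]_(1 + 1) :=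
  mx2 0 (-1) 1 0 *m col2 (derive1 u x) (derive1 v x)
  + mx2 (- p x) (q x) (q x) (p x) *m col2 (u x) (v x).

Definition dirac_solution (R : realType) (p q : R -> R) (lambda : R)
    (u v : R -> R) : Prop :=
  [/\ loc_abs_continuous u,
      loc_abs_continuous v &
      {ae @lebesgue_measure R, forall x, 0 < x ->
        [/\ derivable u x 1,
            derivable v x 1 &
            dirac_op p q u v x = lambda *: col2 (u x) (v x)]}].

Definition dirac_eigenvalue (R : realType) (p q : R -> R) (phi0 lambda : R) :
    Prop :=
  exists u v : R -> R,
    [/\ dirac_solution p q lambda u v,
        (exists2 x : R, 0 <= x & col2 (u x) (v x) != 0),
        u 0 * sin phi0 - v 0 * cos phi0 = 0,
        L2_halfline u &
        L2_halfline v].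

(* Main.v *)
Require Import Defs.
From mathcomp Require Import all_boot all_order all_algebra.
From mathcomp Require Import all_classical all_reals all_analysis.
From mathcomp Require Import measurable_realfun ring lra.
Set Implicit Arguments.
Unset Strict Implicit.
Unset Printing Implicit Defensive.
Import Order.TTheory GRing.Theory Num.Theory.
Import numFieldNormedType.Exports.
Local Open Scope classical_set_scope.
Local Open Scope ring_scope.

(** In Pruefer coordinates u = r cos theta, v = r sin theta, the equation
    L_{p,q} (u, v)^T = lambda (u, v)^T becomes
      r' / r = - (q cos 2 theta + p sin 2 theta),
      theta' = q sin 2 theta - p cos 2 theta - lambda.
    For any strength Q, the choice p = Q sin 2 theta, q = Q cos 2 theta makes
    the potential act on the amplitude only: it leaves theta' = - lambda, hence
    theta(x) = phi0 - lambda x, which satisfies the boundary condition, and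
    r' = - Q r, while sqrt (p ^ 2 + q ^ 2) = |Q|.  The potential thus rotates
    in phase with the solution and damps it as fast as its size allows
    (rotating_dirac_op, rotating_pq_norm).

    It remains to find Q >= 0 with x Q(x) --> A and r in L^2.  The choice
    Q = A / (1 + x), r = (1 + x) ^ (- A), works for A > 1/2 but fails to be
    square integrable at A = 1/2.  An additional logarithmic factor covers every
    A >= 1/2 at once: for w(x) = 1 / (1 + ln (1 + x)),
      r(x) = (1 + x) ^ (- A) w(x),    Q(x) = - r' / r = (A + w(x)) / (1 + x).
    As w --> 0 the limit of x Q(x) is unaffected (cvg_mul_strength), and
    r ^ 2 <= w ^ 2 / (1 + x) = - w' is integrable since w has a limit
    (L2_halfline_le_amplitude).  Square integrability of Q follows likewise from
    Q ^ 2 <= (A + 1) ^ 2 / (1 + x) ^ 2 (L2_halfline_le_strength). *)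

(** * Limits, absolute continuity and square integrability *)

Lemma limf_esup_cvg {R : realType} (F : set_system R) (FF : ProperFilter F)
    (f : R -> R) (l : R) :
  f x @[x --> F] --> l -> limf_esup (fun x => (f x)%:E) F = l%:E.
Proof.
move=> fl; apply/eqP; rewrite eq_le; apply/andP; split.
- apply/lee_addgt0Pr => e e0; apply: ge_ereal_inf.
  exists (ereal_sup ((fun x => (f x)%:E) @` [set x | f x <= l + e])).
    exists [set x | f x <= l + e] => //=.
    move/cvgrPdist_le : fl => /(_ _ e0); apply: filterS => x /=.
    by rewrite ler_distlC => /andP[].
  by apply: ge_ereal_sup => _ [x /= fx <-]; rewrite -EFinD lee_fin.
- apply: le_ereal_inf_tmp => _ [V FV <-].
  apply/lee_subgt0Pr => e e0.
  have [x [Vx fx]] : V `&` [set x | l - e <= f x] !=set0.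
    have FW : F [set x | l - e <= f x].
      move/cvgrPdist_le : fl => /(_ _ e0); apply: filterS => x /=.
      by rewrite ler_distlC => /andP[].
    exact: filter_ex (filterI FV FW).
  apply: (@le_trans _ _ (f x)%:E); first by rewrite -EFinB lee_fin.
  by apply: ereal_sup_ubound; exists x.
Qed.

(** By the mean value theorem f is K-Lipschitz, so e / (K + 1) is a modulus of
    absolute continuity; the + 1 covers K = 0. *)
Lemma loc_abs_continuous_bounded_derive {R : realType} (f df : R -> R) (K : R) :
  (forall x : R, 0 <= x -> is_derive x 1 f (df x)) ->
  (forall x : R, 0 <= x -> `|df x| <= K) ->
  loc_abs_continuous f.
Proof.
move=> fdf dfK b _ e e0.
have K0 : 0 <= K := le_trans (normr_ge0 _) (dfK _ (lexx 0)).
have lip s t : 0 <= s -> s <= t -> `|f t - f s| <= K * (t - s).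
  move=> s0 st.
  have [c + ->] : exists2 c, c \in `[s, t]%R & f t - f s = df c * (t - s).
    apply: MVT_segment => // [x|].
      by rewrite in_itv /= => /andP[sx _]; apply: fdf; lra.
    apply: derivable_within_continuous => x.
    rewrite in_itv /= => /andP[sx _].
    by have [] := fdf _ (le_trans s0 sx).
  rewrite in_itv /= => /andP[sc _]; rewrite normrM [`|t - s|]ger0_norm ?subr_ge0//.
  by apply: ler_wpM2r; [rewrite subr_ge0|apply: dfK; lra].
exists (e / (K + 1)); first by rewrite divr_gt0//; lra.
move=> n s t st _ small.
apply: (@le_lt_trans _ _ (\sum_(i < n) K * (t i - s i))).
  by apply: ler_sum => i _; have [] := st i => *; exact: lip.
rewrite -mulr_sumr.
have sum_ge0 : 0 <= \sum_(i < n) (t i - s i).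
  by apply: sumr_ge0 => i _; have [] := st i; rewrite subr_ge0.
apply: (@le_lt_trans _ _ ((K + 1) * \sum_(i < n) (t i - s i))).
  by apply: ler_wpM2r => //; lra.
by rewrite mulrC -ltr_pdivlMr//; lra.
Qed.

(** The fundamental theorem of calculus bounds the integral of f ^ 2 by the
    total increase l - G 0 of an explicit primitive G of a majorant, which
    avoids any comparison with integrals of powers. *)
Lemma L2_halfline_dominated {R : realType} (f g G : R -> R) (l : R) :
  (forall x : R, 0 <= x -> {for x, continuous f}) ->
  (forall x : R, 0 <= x -> {for x, continuous g}) ->
  (forall x : R, 0 <= x -> is_derive x 1 G (g x)) ->
  G x @[x --> +oo] --> l ->
  (forall x : R, 0 <= x -> f x ^+ 2 <= g x) ->
  L2_halfline f.
Proof.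
move=> cf cg dG Gl fg.
have within_halfline (h : R -> R) : (forall x : R, 0 <= x -> {for x, continuous h}) ->
    {within `[0, +oo[, continuous h}.
  move=> ch; apply/continuous_within_itvcyP; split.
    by move=> x; rewrite in_itv /= andbT => /ltW; exact: ch.
  exact/cvg_at_right_filter/ch.
have mhalf (h : R -> R) : (forall x : R, 0 <= x -> {for x, continuous h}) ->
    measurable_fun (`[0, +oo[%classic : set R) h.
  by move=> /within_halfline; exact: subspace_continuous_measurable_fun.
have mf := mhalf _ cf.
have mf0 : measurable_fun setT (f \_ `[0, +oo[).
  by apply/(measurable_restrictT _ _).1.
have intg : (\int[lebesgue_measure]_(x in `[0%R, +oo[) (g x)%:E < +oo)%E.
  rewrite (@ge0_continuous_FTC2y _ g G 0 l) ?ltry//.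
  - by move=> x /fg; apply: le_trans; exact: sqr_ge0.
  - exact: within_halfline.
  - by move=> x /ltW /dG[].
  - apply: cvg_at_right_filter; apply: differentiable_continuous.
    by apply/derivable1_diffP; have [] := dG _ (lexx 0).
  - move=> x; rewrite in_itv /= andbT => /ltW x0.
    by rewrite derive1E; have [] := dG _ x0.
rewrite /L2_halfline inE; apply/andP; split; rewrite inE //=.
rewrite /finite_norm unlock poweR_lty //=.
apply: le_lt_trans intg.
rewrite [leRHS]integral_mkcond; apply: ge0_le_integral => //.
- apply/measurable_EFinP.
  by apply: (measurableT_comp (measurable_powR _)) => //; exact: measurableT_comp.
- apply/(measurable_restrictT _ _).1 => //.
  by apply/measurable_EFinP; exact: mhalf.
- move=> x _; rewrite /= !patchE; case: ifPn => x0; last first.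
    by rewrite normr0 powR0.
  rewrite lee_fin powR_mulrn// real_normK ?num_real//; apply: fg.
  by move: x0; rewrite inE /= in_itv /= andbT.
Qed.

Lemma is_derive_continuous {R : realType} (f : R -> R) (x df : R) :
  is_derive x 1 f df -> {for x, continuous f}.
Proof.
by move=> [/derivable1_diffP fx _]; exact: differentiable_continuous.
Qed.

(** * The amplitude and the strength of the potential *)

Definition log_decay {R : realType} (x : R) : R := (1 + ln (1 + x))^-1.

(** This is (1 + x) ^ (- A) / (1 + ln (1 + x)). *)
Definition amplitude {R : realType} (A x : R) : R :=
  expR (- A * ln (1 + x)) * log_decay x.

(** The negative logarithmic derivative of [amplitude A]. *)
Definition strength {R : realType} (A x : R) : R :=
  (A + log_decay x) / (1 + x).

Section Decay.
Variable R : realType.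
Implicit Types A x : R.

Lemma log_decay_gt0 x : 0 <= x -> 0 < log_decay x.
Proof.
move=> x0; rewrite invr_gt0; have : 0 <= ln (1 + x) by apply: ln_ge0; lra.
by move=> ?; lra.
Qed.

Lemma log_decay_le1 x : 0 <= x -> log_decay x <= 1.
Proof.
move=> x0; have lx : 0 <= ln (1 + x) by apply: ln_ge0; lra.
by rewrite /log_decay invf_le1; lra.
Qed.

Lemma is_derive_1D x : is_derive x 1 (fun t : R => 1 + t) 1.
Proof. by apply: is_derive_eq; rewrite add0r mulr1. Qed.

Lemma is_derive_ln1D x : 0 <= x ->
  is_derive x 1 (fun t : R => ln (1 + t)) (1 + x)^-1.
Proof.
move=> x0; have dln : is_derive (1 + x) 1 (@ln R) (1 + x)^-1.
  by apply: is_derive1_ln; lra.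
by have := is_derive1_comp dln (is_derive_1D x); rewrite mulr1.
Qed.

Lemma is_derive_log_decay x : 0 <= x ->
  is_derive x 1 (@log_decay R) (- (log_decay x ^+ 2 / (1 + x))).
Proof.
move=> x0; have lx : 0 <= ln (1 + x) by apply: ln_ge0; lra.
have dln := is_derive_ln1D x0.
have d1 : is_derive x 1 (fun t : R => 1 + ln (1 + t)) (1 + x)^-1.
  by have := is_deriveD (is_derive_cst (1 : R) x 1) dln; rewrite add0r.
have n0 : 1 + ln (1 + x) != 0 by rewrite gt_eqF//; lra.
have := @is_deriveV _ (fun t : R => 1 + ln (1 + t)) _ _ _ n0 d1.
by rewrite /log_decay exprVn scaleNr.
Qed.

Lemma is_derive_amplitude A x : 0 <= x ->
  is_derive x 1 (amplitude A) (- (strength A x * amplitude A x)).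
Proof.
move=> x0; have dln := is_derive_ln1D x0; have dw := is_derive_log_decay x0.
have dl : is_derive x 1 (fun t : R => - A * ln (1 + t)) (- A / (1 + x)).
  by apply: is_derive_eq.
have de : is_derive x 1 (fun t : R => expR (- A * ln (1 + t)))
    (expR (- A * ln (1 + x)) * (- A / (1 + x))).
  exact: (is_derive1_comp (is_derive_expR _) dl).
apply: (is_derive_eq (is_deriveM de dw)).
rewrite /amplitude /strength /GRing.scale /=.
by field; lra.
Qed.

Lemma amplitude_gt0 A x : 0 <= x -> 0 < amplitude A x.
Proof. by move=> x0; rewrite mulr_gt0 ?expR_gt0 ?log_decay_gt0. Qed.

(** Here A >= 1/2 enters: (1 + x) ^ (- 2 A) <= 1 / (1 + x).  The right-hand
    side is minus the derivative of [log_decay]. *)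
Lemma amplitude_sqr_le A x : 1 / 2 <= A -> 0 <= x ->
  amplitude A x ^+ 2 <= log_decay x ^+ 2 / (1 + x).
Proof.
move=> hA x0; rewrite exprMn mulrC ler_wpM2l ?sqr_ge0//.
rewrite -expRM_natl -[leRHS]lnK ?posrE ?invr_gt0; last lra.
rewrite ler_expR lnV ?posrE; last lra.
have lx : 0 <= ln (1 + x) by apply: ln_ge0; lra.
by nra.
Qed.

Lemma amplitude_le1 A x : 1 / 2 <= A -> 0 <= x -> amplitude A x <= 1.
Proof.
move=> hA x0; have lx : 0 <= ln (1 + x) by apply: ln_ge0; lra.
rewrite -[leRHS]mulr1 ler_pM ?expR_ge0 ?log_decay_le1//.
  exact/ltW/log_decay_gt0.
by rewrite -[leRHS]expR0 ler_expR mulNr oppr_le0 mulr_ge0//; lra.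
Qed.

Lemma strength_ge0 A x : 1 / 2 <= A -> 0 <= x -> 0 <= strength A x.
Proof.
by move=> hA x0; have := log_decay_gt0 x0 => ?; rewrite divr_ge0//; lra.
Qed.

Lemma strength_le A x : 1 / 2 <= A -> 0 <= x -> strength A x <= (A + 1) / (1 + x).
Proof.
by move=> hA x0; rewrite ler_pM2r ?invr_gt0 ?lerD2l ?log_decay_le1//; lra.
Qed.

Lemma continuous_strength A x : 0 <= x -> {for x, continuous (strength A)}.
Proof.
move=> x0; apply: (@cvgM _ _ _ _ (fun t => A + log_decay t) (fun t => (1 + t)^-1)).
  by apply: cvgD; [exact: cvg_cst|exact: is_derive_continuous (is_derive_log_decay x0)].
by apply: cvgV; [lra|exact: is_derive_continuous (is_derive_1D x)].
Qed.

Lemma cvg_inv1D_pinfty : (1 + x)^-1 @[x --> +oo%R] --> (0 : R).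
Proof.
apply/gtr0_cvgV0 => //; last exact: cvg_addrl.
by near=> x; have : 0 <= x by []; lra.
Unshelve. all: by end_near. Qed.

Lemma cvg_log_decay_pinfty : log_decay x @[x --> +oo%R] --> (0 : R).
Proof.
have lny : ln (1 + x) @[x --> (+oo : set_system R)] --> (+oo : set_system R).
  apply/cvgryPge => M; near=> x.
  rewrite -ler_expR lnK ?posrE.
    have : expR M <= x by []. lra.
  have : 0 <= x by []; lra.
apply/gtr0_cvgV0 => //; last exact: cvg_comp lny (cvg_addrl 1).
by near=> x; rewrite -invr_gt0; apply: log_decay_gt0.
Unshelve. all: by end_near. Qed.

(** On writing x / (1 + x) = 1 - 1 / (1 + x), both correction terms vanish at
    infinity. *)
Lemma cvg_mul_strength A : x * strength A x @[x --> +oo] --> A.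
Proof.
have : (1 - (1 + x)^-1) * (A + log_decay x) @[x --> +oo] --> (1 - 0) * (A + 0).
  apply: cvgM; first by apply: cvgB; [exact: cvg_cst|exact: cvg_inv1D_pinfty].
  by apply: cvgD; [exact: cvg_cst|exact: cvg_log_decay_pinfty].
rewrite subr0 mul1r addr0; apply: cvg_trans; apply: near_eq_cvg.
near=> x; rewrite /strength; field.
have : 0 <= x by []; lra.
Unshelve. all: by end_near. Qed.

Lemma L2_halfline_le_strength A (f : R -> R) : 1 / 2 <= A ->
  (forall x, 0 <= x -> {for x, continuous f}) ->
  (forall x, 0 <= x -> f x ^+ 2 <= strength A x ^+ 2) ->
  L2_halfline f.
Proof.
move=> hA cf fQ.
pose g (x : R) := (A + 1) ^+ 2 * (1 + x)^-1 ^+ 2.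
pose G (x : R) := - (A + 1) ^+ 2 * (1 + x)^-1.
have dinv (x : R) : 0 <= x ->
    is_derive x 1 (fun t : R => (1 + t)^-1) (- (1 + x)^-1 ^+ 2).
  move=> x0; have n0 : 1 + x != 0 by rewrite gt_eqF//; lra.
  apply: (is_derive_eq (is_deriveV n0 (is_derive_1D x))).
  by rewrite /GRing.scale /= exprVn mulr1.
apply: (L2_halfline_dominated (g:=g) (G:=G) (l:=- (A + 1) ^+ 2 * 0)) => //.
- move=> x x0; have ci := is_derive_continuous (dinv _ x0).
  by apply: cvgM; [exact: cvg_cst|exact: (cvgM ci ci)].
- move=> x /dinv dx; apply: is_derive_eq.
  by rewrite /g /GRing.scale /=; ring.
- by apply: cvgM; [exact: cvg_cst|exact: cvg_inv1D_pinfty].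
- move=> x x0; apply: le_trans (fQ x x0) _.
  rewrite /g -exprMn ler_sqr ?nnegrE ?strength_ge0 ?strength_le//.
  by rewrite divr_ge0//; lra.
Qed.

Lemma L2_halfline_le_amplitude A (f : R -> R) : 1 / 2 <= A ->
  (forall x, 0 <= x -> {for x, continuous f}) ->
  (forall x, 0 <= x -> f x ^+ 2 <= amplitude A x ^+ 2) ->
  L2_halfline f.
Proof.
move=> hA cf fr.
apply: (L2_halfline_dominated (g:=fun x => log_decay x ^+ 2 / (1 + x))
  (G:=fun x => - log_decay x) (l:=- 0)) => //.
- move=> x x0; have cw := is_derive_continuous (is_derive_log_decay x0).
  apply: cvgM; first exact: (cvgM cw cw).
  apply: cvgV; first by rewrite gt_eqF//; lra.
  exact: is_derive_continuous (is_derive_1D x).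
- move=> x x0; apply: (is_derive_eq (is_deriveN (is_derive_log_decay x0))).
  by rewrite opprK.
- by apply: cvgN; exact: cvg_log_decay_pinfty.
- by move=> x x0; apply: le_trans (fr x x0) _; exact: amplitude_sqr_le.
Qed.

End Decay.

(** * Potentials rotating in phase with the solution *)

Section Rotating_solution.
Variables (R : realType) (Q r : R -> R) (phi0 lambda : R).

Let c (x : R) : R := cos (phi0 - lambda * x).
Let s (x : R) : R := sin (phi0 - lambda * x).

(** With theta = phi0 - lambda x, the potentials are Q sin 2 theta and
    Q cos 2 theta; expanding the double angles reduces every identity below to
    the ring axioms and cos ^ 2 + sin ^ 2 = 1. *)
Definition rotating_p (x : R) : R := Q x * (2 * (s x * c x)).
Definition rotating_q (x : R) : R := Q x * (c x ^+ 2 - s x ^+ 2).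
Definition rotating_u (x : R) : R := r x * c x.
Definition rotating_v (x : R) : R := r x * s x.

Let is_derive_phase (x : R) :
  is_derive x 1 (fun t : R => phi0 - lambda * t) (- lambda).
Proof. by apply: is_derive_eq; rewrite /GRing.scale /=; ring. Qed.

Let is_derive_c (x : R) : is_derive x 1 c (lambda * s x).
Proof.
apply: (is_derive_eq (is_derive1_comp (is_derive_cos _) (is_derive_phase x))).
by rewrite mulrNN mulrC.
Qed.

Let is_derive_s (x : R) : is_derive x 1 s (- (lambda * c x)).
Proof.
apply: (is_derive_eq (is_derive1_comp (is_derive_sin _) (is_derive_phase x))).
by rewrite mulrN mulrC.
Qed.

Lemma rotating_pq_norm (x : R) :
  Num.sqrt (rotating_p x ^+ 2 + rotating_q x ^+ 2) = `|Q x|.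
Proof.
have cs : c x ^+ 2 + s x ^+ 2 = 1 by exact: cos2Dsin2.
rewrite (_ : _ + _ = (Q x * (c x ^+ 2 + s x ^+ 2)) ^+ 2).
  by rewrite cs mulr1 sqrtr_sqr.
by rewrite /rotating_p /rotating_q; ring.
Qed.

Lemma rotating_p_sqr_le (x : R) : rotating_p x ^+ 2 <= Q x ^+ 2.
Proof.
rewrite -(real_normK (num_real (Q x))) -rotating_pq_norm.
by rewrite sqr_sqrtr ?lerDl ?addr_ge0 ?sqr_ge0.
Qed.

Lemma rotating_q_sqr_le (x : R) : rotating_q x ^+ 2 <= Q x ^+ 2.
Proof.
rewrite -(real_normK (num_real (Q x))) -rotating_pq_norm.
by rewrite sqr_sqrtr ?lerDr ?addr_ge0 ?sqr_ge0.
Qed.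

Lemma rotating_u_sqr_le (x : R) : rotating_u x ^+ 2 <= r x ^+ 2.
Proof.
rewrite exprMn ler_piMr ?sqr_ge0//.
by rewrite -(cos2Dsin2 (phi0 - lambda * x)) lerDl sqr_ge0.
Qed.

Lemma rotating_v_sqr_le (x : R) : rotating_v x ^+ 2 <= r x ^+ 2.
Proof.
rewrite exprMn ler_piMr ?sqr_ge0//.
by rewrite -(cos2Dsin2 (phi0 - lambda * x)) lerDr sqr_ge0.
Qed.

Lemma continuous_rotating_p (x : R) :
  {for x, continuous Q} -> {for x, continuous rotating_p}.
Proof.
move=> Qx; apply: (cvgM Qx); apply: cvgM; first exact: cvg_cst.
by apply: cvgM; [exact: is_derive_continuous (is_derive_s x)|
  exact: is_derive_continuous (is_derive_c x)].
Qed.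

Lemma continuous_rotating_q (x : R) :
  {for x, continuous Q} -> {for x, continuous rotating_q}.
Proof.
have cc := is_derive_continuous (is_derive_c x).
have cs := is_derive_continuous (is_derive_s x).
move=> Qx; apply: (cvgM Qx); apply: cvgB; rewrite /expr2 /=.
  exact: (cvgM cc cc).
exact: (cvgM cs cs).
Qed.

Hypothesis is_derive_r :
  forall x : R, 0 <= x -> is_derive x 1 r (- (Q x * r x)).

Lemma is_derive_rotating_u (x : R) : 0 <= x ->
  is_derive x 1 rotating_u (- (Q x * rotating_u x) + lambda * rotating_v x).
Proof.
move=> x0.
have dru := is_deriveM (is_derive_r x0) (is_derive_c x).
apply: (is_derive_eq dru).
by rewrite /rotating_u /rotating_v /GRing.scale /=; ring.
Qed.

Lemma is_derive_rotating_v (x : R) : 0 <= x ->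
  is_derive x 1 rotating_v (- (Q x * rotating_v x) - lambda * rotating_u x).
Proof.
move=> x0.
have drv := is_deriveM (is_derive_r x0) (is_derive_s x).
apply: (is_derive_eq drv).
by rewrite /rotating_u /rotating_v /GRing.scale /=; ring.
Qed.

(** Since (u, v) = r (cos theta, sin theta), the potential matrix, a reflection
    scaled by Q, sends (u, v) to Q (- v, u); this is the opposite of what the
    damping terms - Q u, - Q v of u', v' contribute to (- v', u'). *)
Lemma rotating_dirac_op (x : R) : 0 <= x ->
  dirac_op rotating_p rotating_q rotating_u rotating_v x =
  lambda *: col2 (rotating_u x) (rotating_v x).
Proof.
move=> x0; have cs : c x ^+ 2 + s x ^+ 2 = 1 by exact: cos2Dsin2.
have [_ du] := is_derive_rotating_u x0.
have [_ dv] := is_derive_rotating_v x0.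
rewrite /dirac_op /mx2 /col2 !derive1E du dv.
rewrite !mul_block_col add_col_mx scale_col_mx.
rewrite -!scalar_mxM -!raddfD /= !scale_scalar_mx.
congr col_mx; congr (_%:M).
(* The damping term is made homogeneous of degree 3 in cos and sin, the degree
   of the potential terms, after which the identity is polynomial. *)
- rewrite /rotating_p /rotating_q /rotating_u /rotating_v.
  have -> : Q x * (r x * s x) = Q x * r x * s x * (c x ^+ 2 + s x ^+ 2).
    by rewrite cs; ring.
  by ring.
- rewrite /rotating_p /rotating_q /rotating_u /rotating_v.
  have -> : Q x * (r x * c x) = Q x * r x * c x * (c x ^+ 2 + s x ^+ 2).
    by rewrite cs; ring.
  by ring.
Qed.

Lemma rotating_dirac_solution (K : R) :
  (forall x : R, 0 <= x -> `|Q x| <= K) ->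
  (forall x : R, 0 <= x -> `|r x| <= 1) ->
  dirac_solution rotating_p rotating_q lambda rotating_u rotating_v.
Proof.
move=> QK r1.
have u1 (x : R) : 0 <= x -> `|rotating_u x| <= 1.
  move=> x0; apply: le_trans (r1 x x0).
  by rewrite -ler_sqr ?nnegrE// !real_normK ?num_real// rotating_u_sqr_le.
have v1 (x : R) : 0 <= x -> `|rotating_v x| <= 1.
  move=> x0; apply: le_trans (r1 x x0).
  by rewrite -ler_sqr ?nnegrE// !real_normK ?num_real// rotating_v_sqr_le.
split.
- apply: (loc_abs_continuous_bounded_derive (K:=K + `|lambda|)
    is_derive_rotating_u) => x x0.
  rewrite (le_trans (ler_normD _ _))// normrN (normrM (Q x)) (normrM lambda).
  by apply: lerD; rewrite -[leRHS]mulr1 ler_pM ?u1 ?v1 ?QK.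
- apply: (loc_abs_continuous_bounded_derive (K:=K + `|lambda|)
    is_derive_rotating_v) => x x0.
  rewrite (le_trans (ler_normB _ _))// normrN (normrM (Q x)) (normrM lambda).
  by apply: lerD; rewrite -[leRHS]mulr1 ler_pM ?u1 ?v1 ?QK.
- apply: aeW => x /ltW x0; split; last exact: rotating_dirac_op.
    by have [] := is_derive_rotating_u x0.
  by have [] := is_derive_rotating_v x0.
Qed.

End Rotating_solution.

Theorem theorem1p2 (R : realType) (phi0 lambda A : R)
    (hphi0 : 0 <= phi0) (hphi0_pi : phi0 < pi) (hA : 1 / 2 <= A) :
  exists p q : R -> R,
    [/\ L2_halfline p,
        L2_halfline q,
        limf_esup (fun x : R => (x * Num.sqrt (p x ^+ 2 + q x ^+ 2))%:E)
          (pinfty_nbhs R) = A%:E &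
        dirac_eigenvalue p q phi0 lambda].
Proof.
pose Q : R -> R := strength A; pose r : R -> R := amplitude A.
pose p := rotating_p Q phi0 lambda; pose q := rotating_q Q phi0 lambda.
pose u := rotating_u r phi0 lambda; pose v := rotating_v r phi0 lambda.
have dr (x : R) : 0 <= x -> is_derive x 1 r (- (Q x * r x)).
  exact: is_derive_amplitude.
have cQ (x : R) : 0 <= x -> {for x, continuous Q} by exact: continuous_strength.
have Q0 (x : R) : 0 <= x -> 0 <= Q x by exact: strength_ge0.
exists p, q; split.
- apply: (L2_halfline_le_strength hA) => x x0; last exact: rotating_p_sqr_le.
  by apply: continuous_rotating_p; exact: cQ.
- apply: (L2_halfline_le_strength hA) => x x0; last exact: rotating_q_sqr_le.
  by apply: continuous_rotating_q; exact: cQ.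
- apply: limf_esup_cvg; apply: cvg_trans (@cvg_mul_strength R A).
  apply: near_eq_cvg; near=> x.
  by rewrite rotating_pq_norm ger0_norm// Q0.
- exists u, v; split.
  + apply: (rotating_dirac_solution phi0 lambda dr (K:=A + 1)) => x x0.
    * rewrite ger0_norm ?Q0//; apply: le_trans (strength_le hA x0) _.
      by rewrite ler_pdivrMr; nra.
    * by rewrite gtr0_norm ?amplitude_gt0// amplitude_le1.
  + exists 0 => //; apply/eqP => uv0.
    have [u0 v0] : u 0 = 0 /\ v 0 = 0.
      move/(congr1 (fun M => (usubmx M 0 0, dsubmx M 0 0))) : uv0.
      by rewrite /col2 col_mxKu col_mxKd !mxE /= => -[].
    have r0 : 0 < r 0 by exact: amplitude_gt0.
    have : r 0 ^+ 2 = u 0 ^+ 2 + v 0 ^+ 2.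
      by rewrite !exprMn -mulrDr cos2Dsin2 mulr1.
    by rewrite u0 v0 expr0n addr0 => /eqP; rewrite expf_eq0 gt_eqF.
  + by rewrite /u /v /rotating_u /rotating_v mulr0 subr0; ring.
  + apply: (L2_halfline_le_amplitude hA) => x x0; last exact: rotating_u_sqr_le.
    exact: is_derive_continuous (is_derive_rotating_u phi0 lambda dr x0).
  + apply: (L2_halfline_le_amplitude hA) => x x0; last exact: rotating_v_sqr_le.
    exact: is_derive_continuous (is_derive_rotating_v phi0 lambda dr x0).
Unshelve. all: by end_near. Qed.
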